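(* Let $H:\mathbb{R}^N\to\mathbb{R}$ be differentiable, let $\overline{\nabla}H:\mathbb{R}^N\times\mathbb{R}^N\to\mathbb{R}^N$ be a discrete gradient of $H$, let $G:\mathbb{R}^N\to\mathbb{R}^{N\times N}$, and let $\overline{G}:\mathbb{R}^N\times\mathbb{R}^N\to\mathbb{R}^{N\times N}$ be an approximation to $G$. Let the times $t^{(0)}<t^{(1)}<t^{(2)}<\cdots$ and the states $u^{(n)}\in\mathbb{R}^N$ satisfy, for every $n$, $$\frac{u^{(n+1)}-u^{(n)}}{t^{(n+1)}-t^{(n)}}=\overline{G}(u^{(n+1)},u^{(n)})\,\overline{\nabla}H(u^{(n+1)},u^{(n)}).$$ (i) If $\overline{G}(v,w)\le O$ for all $v,w\in\mathbb{R}^N$, then the discrete energy dissipation law holds: for every $n$, $$\frac{H(u^{(n+1)})-H(u^{(n)})}{t^{(n+1)}-t^{(n)}}\le 0.$$ Moreover, in this case this rate of energy dissipation is an approximation of that of the continuous system $\frac{\mathrm{d}u}{\mathrm{d}t}=G(u)\nabla H(u)$, in the following sense: for every $n$, $$\frac{H(u^{(n+1)})-H(u^{(n)})}{t^{(n+1)}-t^{(n)}}=\overline{\nabla}H(u^{(n+1)},u^{(n)})\cdot\overline{G}(u^{(n+1)},u^{(n)})\,\overline{\nabla}H(u^{(n+1)},u^{(n)}),$$ and the function $(v,w)\mapsto\overline{\nabla}H(v,w)\cdot\overline{G}(v,w)\overline{\nabla}H(v,w)$ coincides at $v=w=u$ with $\nabla H(u)\cdot G(u)\nabla H(u)$ for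 every $u\in\mathbb{R}^N$, which is the value of $\frac{\mathrm{d}}{\mathrm{d}t}H$ along solutions of the continuous system at the state $u$. (ii) If $\overline{G}(v,w)$ is skew-symmetric for all $v,w\in\mathbb{R}^N$, then the discrete energy conservation law holds: $H(u^{(n+1)})=H(u^{(n)})$ for every $n$. (iii) If the row vector $\vec{1}=(1,1,\ldots,1)$ is in the left kernel of $\overline{G}$, i.e. $\vec{1}\,\overline{G}(v,w)=\vec{0}$ for all $v,w\in\mathbb{R}^N$, then the discrete mass conservation law holds: $\sum_k u_k^{(n+1)}=\sum_k u_k^{(n)}$ for every $n$.
   Context: The symbol $\cdot$ denotes an inner product on $\mathbb{R}^N$ of the form $v\cdot w=c\sum_{k=1}^N v_kw_k$, where either $c=1$ (the standard inner product, used for ODEs) or $c=\Delta x>0$, a fixed space mesh size (the discrete $L^2$ inner product, used for discretized PDEs). The gradient $\nabla H(u)$ is taken with respect to this inner product, i.e. $\nabla H(u)\cdot w=\mathrm{d}H(w;u)$ for all $w$, where $\mathrm{d}H(\cdot;u)$ is the Fréchet derivative of $H$ at $u$. A discrete gradient of $H$ is a function $\overline{\nabla}H:\mathbb{R}^N\times\mathbb{R}^N\to\mathbb{R}^N$ satisfying, for all $u,v\in\mathbb{R}^N$, $$H(u)-H(v)=\overline{\nabla}H(u,v)\cdot(u-v),\qquad \overline{\nabla}H(u,u)=\nabla H(u).$$ ''$\overline{G}$ is an approximation to $G$'' means $\overline{G}(u,u)=G(u)$ for all $u\in\mathbb{R}^N$. For a real square matrix $A$ (not assumed symmetric), $A\le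 O$ means $x^\top Ax\le 0$ for every vector $x$; $A$ is skew-symmetric if $A^\top=-A$. The component $u_k^{(n)}$ is the $k$-th entry of $u^{(n)}$. *)

(* Defs.v *)
From HB Require Import structures.
From mathcomp Require Import all_boot all_order all_algebra.
From mathcomp Require Import boolp classical_sets reals topology normedtype derive.

Set Implicit Arguments.
Unset Strict Implicit.
Unset Printing Implicit Defensive.

Import Order.TTheory GRing.Theory Num.Theory.
Import numFieldNormedType.Exports.

Local Open Scope classical_set_scope.
Local Open Scope ring_scope.

Section DiscreteGradient.
Variables (R : realType) (N : nat).
Implicit Types (c : R) (H : 'cV[R]_N -> R) (u v w g : 'cV[R]_N) (A : 'M[R]_N).

(* The weight c is 1 for ODEs and the mesh size for discretized PDEs. *)
Definition ip c v w : R := c * \sum_(k < N) v k 0 * w k 0.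

(* For 0 < c, exactly one vector satisfies the defining condition
   (gradP and grad_unique). *)
Definition grad c H u : 'cV[R]_N :=
  get [set g | forall w, ip c g w = 'd H u w].

Definition discrete_gradient c H
    (gradbar : 'cV[R]_N -> 'cV[R]_N -> 'cV[R]_N) :=
  (forall u v, H u - H v = ip c (gradbar u v) (u - v)) /\
  (forall u, gradbar u u = grad c H u).

Definition approximation (Gbar : 'cV[R]_N -> 'cV[R]_N -> 'M[R]_N)
    (G : 'cV[R]_N -> 'M[R]_N) :=
  forall u, Gbar u u = G u.

(* No symmetry is required of A. *)
Definition neg_semidef A := forall x : 'cV[R]_N, (x^T *m A *m x) 0 0 <= 0.

Definition skew_symmetric A := A^T = - A.

Definition solution c H (G : 'cV[R]_N -> 'M[R]_N) (I : set R)
    (x : R -> 'cV[R]_N) :=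
  forall s, I s -> is_derive s 1 x (G (x s) *m grad c H (x s)).

Lemma ip_delta c g (k : 'I_N) : ip c g (delta_mx k 0) = c * g k 0.
Proof.
rewrite /ip (bigD1 k) //= !mxE !eqxx mulr1 big1 ?addr0 // => i /negPf ik.
by rewrite !mxE ik mulr0.
Qed.

Lemma grad_unique c H u g g' : 0 < c ->
  (forall w, ip c g w = 'd H u w) -> (forall w, ip c g' w = 'd H u w) -> g = g'.
Proof.
move=> c0 hg hg'; apply/colP => k.
have := hg (delta_mx k 0); rewrite -hg' !ip_delta.
by apply: mulfI; rewrite gt_eqF.
Qed.

Lemma gradP c H u : 0 < c ->
  forall w, ip c (grad c H u) w = 'd H u w.
Proof.
move=> c0.
have e : [set g | forall w, ip c g w = 'd H u w]
    (\col_k (c^-1 * 'd H u (delta_mx k 0))).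
  move=> w /=; rewrite [in RHS](matrix_sum_delta w) linear_sum /ip mulr_sumr.
  apply: eq_bigr => k _; rewrite big_ord1 linearZ mxE /=.
  by rewrite -mulrA mulVKf ?gt_eqF // mulrC.
exact: (getPex (ex_intro _ _ e)).
Qed.

End DiscreteGradient.

(* Main.v *)
Require Import Defs.
From mathcomp Require Import all_boot all_order all_algebra.
From mathcomp Require Import boolp classical_sets reals topology normedtype derive.

Set Implicit Arguments.
Unset Strict Implicit.
Unset Printing Implicit Defensive.

Import Order.TTheory GRing.Theory Num.Theory.
Import numFieldNormedType.Exports.

Local Open Scope classical_set_scope.
Local Open Scope ring_scope.

(** The discrete gradient supplies an exact discrete chain rule: the increment of [H] over a step is
    the inner product of [gradbar] with the increment of [u]. Dividing by the time step and
    inserting the scheme makes the energy rate [c] times the quadratic form of [Gbar] at [gradbar]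
    ([ipE], [ipZr]). Its sign gives dissipation, its vanishing for skew matrices
    ([quadratic_skew_eq0]) gives conservation, and on the diagonal it becomes the continuous rate
    ([is_derive_along_solution]). Mass conservation does not involve the energy: it comes from
    multiplying the scheme by the row of ones. *)

Lemma ipE (R : realType) (N : nat) (c : R) (v w : 'cV[R]_N) :
  ip c v w = c * (v^T *m w) 0 0.
Proof. by rewrite /ip mxE; congr (_ * _); apply: eq_bigr => k _; rewrite mxE. Qed.

Lemma ipZr (R : realType) (N : nat) (c a : R) (v w : 'cV[R]_N) :
  ip c v (a *: w) = a * ip c v w.
Proof. by rewrite !ipE -scalemxAr mxE mulrCA. Qed.

(** A 1 by 1 matrix has the same entry as its transpose, while skewness makes transposition negate
    this product; the entry is therefore its own opposite. *)
Lemma quadratic_skew_eq0 (R : realType) (N : nat) (A : 'M[R]_N) (x : 'cV[R]_N) :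
  skew_symmetric A -> (x^T *m A *m x) 0 0 = 0.
Proof.
move=> skA; apply/eqP; rewrite -eqNr; apply/eqP.
have tr : (x^T *m A *m x)^T = - (x^T *m A *m x).
  by rewrite !trmx_mul trmxK skA mulNmx mulmxN mulmxA.
by have /matrixP/(_ 0 0) := tr; rewrite [LHS]mxE [RHS]mxE => <-.
Qed.

(** By the chain rule the derivative is the differential of [H] applied to the velocity of [x];
    [gradP] turns it into an inner product, and the equation supplies the velocity. *)
Lemma is_derive_along_solution (R : realType) (N : nat) (c : R)
    (H : 'cV[R]_N -> R) (G : 'cV[R]_N -> 'M[R]_N) (I : set R)
    (x : R -> 'cV[R]_N) (s : R) :
  0 < c -> differentiable H (x s) -> solution c H G I x -> I s ->
  is_derive s 1 (H \o x)
    (ip c (grad c H (x s)) (G (x s) *m grad c H (x s))).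
Proof.
move=> c_gt0 dH sol Is; have [xs xsE] := sol s Is.
have dx : differentiable x s by exact/derivable1_diffP.
have dHx : differentiable (H \o x) s by exact: differentiable_comp.
apply: DeriveDef; first exact/derivable1_diffP.
by rewrite deriveE // diff_comp //= gradP // -xsE (deriveE _ dx).
Qed.

Theorem theorem3 (R : realType) (N : nat) (c : R) (hc : 0 < c)
    (H : 'cV[R]_N -> R) (hH : forall v : 'cV[R]_N, differentiable H v)
    (gradbar : 'cV[R]_N -> 'cV[R]_N -> 'cV[R]_N) (hgradbar : discrete_gradient c H gradbar)
    (G : 'cV[R]_N -> 'M[R]_N) (Gbar : 'cV[R]_N -> 'cV[R]_N -> 'M[R]_N)
    (hGbar : approximation Gbar G)
    (t : nat -> R) (ht : forall n : nat, t n < t n.+1)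
    (u : nat -> 'cV[R]_N)
    (hu : forall n : nat,
      (t n.+1 - t n)^-1 *: (u n.+1 - u n) =
      Gbar (u n.+1) (u n) *m gradbar (u n.+1) (u n)) :
  ((forall v w : 'cV[R]_N, neg_semidef (Gbar v w)) ->
    [/\ forall n : nat, (H (u n.+1) - H (u n)) / (t n.+1 - t n) <= 0,
        forall n : nat,
          (H (u n.+1) - H (u n)) / (t n.+1 - t n) =
          ip c (gradbar (u n.+1) (u n))
               (Gbar (u n.+1) (u n) *m gradbar (u n.+1) (u n)),
        forall v : 'cV[R]_N,
          ip c (gradbar v v) (Gbar v v *m gradbar v v) =
          ip c (grad c H v) (G v *m grad c H v)
      & forall (I : set R) (x : R -> 'cV[R]_N),
          open I -> solution c H G I x ->
          forall s : R, I s ->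
          is_derive s 1 (H \o x)
            (ip c (grad c H (x s)) (G (x s) *m grad c H (x s)))])
  /\ ((forall v w : 'cV[R]_N, skew_symmetric (Gbar v w)) ->
      forall n : nat, H (u n.+1) = H (u n))
  /\ ((forall v w : 'cV[R]_N,
         (const_mx 1 : 'rV[R]_N) *m Gbar v w = (0 : 'rV[R]_N)) ->
      forall n : nat,
        \sum_(k < N) u n.+1 k 0 = \sum_(k < N) u n k 0).
Proof.
case: hgradbar => dgE dg_diag.
have dt_gt0 n : 0 < t n.+1 - t n by rewrite subr_gt0.
(* This identity holds without any assumption on the sign or symmetry of [Gbar], so it serves both
   dissipation and conservation. *)
have rateE n : (H (u n.+1) - H (u n)) / (t n.+1 - t n) =
    ip c (gradbar (u n.+1) (u n))
         (Gbar (u n.+1) (u n) *m gradbar (u n.+1) (u n)).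
  by rewrite dgE -hu ipZr mulrC.
split=> [nsdG|]; first split=> //.
- by move=> n; rewrite rateE ipE mulmxA pmulr_rle0 //; exact: nsdG.
- by move=> v; rewrite dg_diag hGbar.
- by move=> I x _ sol s; exact: is_derive_along_solution.
split=> [skG n|kerG n].
  (* The rate vanishes, and the time step is nonzero, so the numerator vanishes. *)
  have /eqP := rateE n.
  rewrite ipE mulmxA quadratic_skew_eq0 // mulr0 mulf_eq0 invr_eq0.
  by rewrite (gt_eqF (dt_gt0 n)) orbF subr_eq0 => /eqP.
(* Writing mass as a product with the row of ones lets the left kernel condition annihilate the
   right side of the scheme. *)
have massE (v : 'cV[R]_N) : \sum_k v k 0 = ((const_mx 1 : 'rV[R]_N) *m v) 0 0.
  by rewrite mxE; apply: eq_bigr => k _; rewrite mxE mul1r.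
have /(congr1 (mulmx (const_mx 1 : 'rV[R]_N))) := hu n.
rewrite mulmxA kerG mul0mx -scalemxAr => /eqP.
rewrite scaler_eq0 invr_eq0 (gt_eqF (dt_gt0 n)) /= mulmxBr subr_eq0 => /eqP eq_mass.
by rewrite !massE eq_mass.
Qed.
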